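(* Given $k$ linear threshold functions $f_1,\ldots,f_k$ on $n$ Boolean variables with weights in $[-n^n,n^n]$, the quantity $\sum_{x\in\{0,1\}^n}\prod_{i=1}^kf_i(x)$ can be computed in $2^{n/2}\cdot n^{O(k)}$ time.
   Context: A linear threshold function on $n$ variables is $f(x)=1$ if $\sum_i w_ix_i\ge t$ and $0$ otherwise; here the weights $w_i$ and threshold $t$ are integers in $[-n^n,n^n]$. *)

(* Defs.v *)
From HB Require Import structures.
From mathcomp Require Import all_boot all_order all_algebra.
From mathcomp Require Import reals exp.

Set Implicit Arguments.
Unset Strict Implicit.
Unset Printing Implicit Defensive.

Import Order.TTheory GRing.Theory Num.Theory.
Local Open Scope ring_scope.

Record ltf (n : nat) := Ltf { weight : 'I_n -> int; threshold : int }.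

Definition ltf_eval (n : nat) (f : ltf n) (x : {ffun 'I_n -> bool}) : bool :=
  threshold f <= \sum_(j < n) weight f j * (x j)%:Z.

Definition ltf_bounded (n : nat) (f : ltf n) : Prop :=
  (forall j : 'I_n, - (n ^ n)%N%:Z <= weight f j <= (n ^ n)%N%:Z) /\
  - (n ^ n)%N%:Z <= threshold f <= (n ^ n)%N%:Z.

(* The model of computation is the random access machine of Aho, Hopcroft and
   Ullman under the logarithmic cost criterion: every constant, register index,
   address, operand and result is charged its bit length.  Control flow is
   structured (if/while), which is a restriction of RAM programs with jumps. *)

Definition bitlen (z : int) : nat := (trunc_log 2 `|z|%N).+1.

Inductive binop := Add | Sub | Mul | Div.

Inductive expr :=
  | Cst of int
  | Reg of nat
  | Bin of binop & expr & expr.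

Inductive cmd :=
  | Skip
  | Assign of nat & expr
  | MemRead of nat & expr
  | MemWrite of expr & expr
  | Seq of cmd & cmd
  | If of expr & cmd & cmd
  | While of expr & cmd.

Record state := State { regs : nat -> int; mem : nat -> int }.

Definition binop_eval (o : binop) (a b : int) : int :=
  match o with
  | Add => a + b
  | Sub => a - b
  | Mul => a * b
  | Div => (a %/ b)%Z
  end.

Fixpoint eval (r : nat -> int) (e : expr) : int :=
  match e with
  | Cst z => z
  | Reg x => r x
  | Bin o e1 e2 => binop_eval o (eval r e1) (eval r e2)
  end.

Fixpoint ecost (r : nat -> int) (e : expr) : nat :=
  match e with
  | Cst z => bitlen z
  | Reg x => bitlen x + bitlen (r x)
  | Bin o e1 e2 => ecost r e1 + ecost r e2 + bitlen (eval r e)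
  end%N.

Definition set_reg (s : state) (x : nat) (v : int) : state :=
  State [eta regs s with x |-> v] (mem s).

Definition set_mem (s : state) (a : nat) (v : int) : state :=
  State (regs s) [eta mem s with a |-> v].

(* [exec p s t s']: started in [s], the program [p] halts in [s'] after time
   [t].  Conditions test whether an expression is positive; an access to a
   negative address has no rule, hence never halts. *)
Inductive exec : cmd -> state -> nat -> state -> Prop :=
  | exec_skip s : exec Skip s 1 s
  | exec_assign s x e :
      exec (Assign x e) s
        (ecost (regs s) e + bitlen x + bitlen (eval (regs s) e))%N
        (set_reg s x (eval (regs s) e))
  | exec_read s x e (a : nat) :
      eval (regs s) e = a%:Z ->
      exec (MemRead x e) s
        (ecost (regs s) e + bitlen x + bitlen (mem s a))%N
        (set_reg s x (mem s a))
  | exec_write s e1 e2 (a : nat) :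
      eval (regs s) e1 = a%:Z ->
      exec (MemWrite e1 e2) s
        (ecost (regs s) e1 + ecost (regs s) e2)%N
        (set_mem s a (eval (regs s) e2))
  | exec_seq s s1 s2 p1 p2 t1 t2 :
      exec p1 s t1 s1 -> exec p2 s1 t2 s2 ->
      exec (Seq p1 p2) s (t1 + t2)%N s2
  | exec_if_true s s1 e p1 p2 t :
      0 < eval (regs s) e -> exec p1 s t s1 ->
      exec (If e p1 p2) s (ecost (regs s) e + t)%N s1
  | exec_if_false s s1 e p1 p2 t :
      eval (regs s) e <= 0 -> exec p2 s t s1 ->
      exec (If e p1 p2) s (ecost (regs s) e + t)%N s1
  | exec_while_true s s1 s2 e p t1 t2 :
      0 < eval (regs s) e -> exec p s t1 s1 -> exec (While e p) s1 t2 s2 ->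
      exec (While e p) s (ecost (regs s) e + t1 + t2)%N s2
  | exec_while_false s e p :
      eval (regs s) e <= 0 ->
      exec (While e p) s (ecost (regs s) e) s.

Lemma exec_det p s t1 s1 t2 s2 :
  exec p s t1 s1 -> exec p s t2 s2 -> t1 = t2 /\ s1 = s2.
Proof.
have contra (z : int) : 0 < z -> z <= 0 -> False.
  by move=> z_gt0; rewrite leNgt z_gt0.
move=> E1; elim: E1 t2 s2 => {p s t1 s1}; intros;
  match goal with E : exec _ _ _ _ |- _ => inversion E; subst; clear E end;
  try (exfalso; eapply contra; eassumption); try by [].
all: repeat match goal with
  | IH : forall t s, exec ?p ?s0 t s -> _, E : exec ?p ?s0 _ _ |- _ =>
      let et := fresh in let es := fresh in
      have [et es] := IH _ _ E; clear E; subst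
  | e1 : eval ?r ?e = Posz ?a, e2 : eval ?r ?e = Posz ?b |- _ =>
      rewrite e1 in e2; case: e2 => e2; subst
  end; by [].
Qed.

(* The input is laid out in memory from address 0 as
   n, k, w_11, .., w_1n, t_1, .., w_k1, .., w_kn, t_k;
   everything else is 0. *)
Definition input (n k : nat) (f : 'I_k -> ltf n) : seq int :=
  [:: n%:Z; k%:Z] ++
  flatten [seq rcons [seq weight (f i) j | j <- enum 'I_n] (threshold (f i))
          | i <- enum 'I_k].

Definition init (inp : seq int) : state :=
  State (fun=> 0) (fun a => nth 0 inp a).

(* Main.v *)
(* Meet in the middle.  Split the variables into two halves of n/2; an assignment
   satisfies f_i iff u_i > v_i, where the left half x determines the vector u
   and the right half y determines v, all entries being naturals below 2^L with
   L = n^2 + n + 2.  Now u > v iff there is a (then unique) l < L such that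
   u / 2^l is odd and equals v / 2^l + 1.  Hence the answer is the sum over
   tuples (l_1, .., l_k) in [L]^k of the number of pairs (x, y) for which this
   holds for all i with l = l_i, and for a fixed tuple this counts pairs of equal
   keys.  Since an access costs only the bit length of its address, the keys are
   used directly as addresses of a table: every (x, tuple) increments its cell,
   every (y, tuple) reads its cell.  There are 2^(n/2) L^k = 2^(n/2) n^O(k)
   accesses on each side, each taking polynomial time in n and k. *)

Require Import Defs.
From HB Require Import structures.
From mathcomp Require Import all_boot all_order all_algebra.
From mathcomp Require Import reals exp.
From mathcomp Require Import zify.
Set Implicit Arguments.
Unset Strict Implicit.
Unset Printing Implicit Defensive.

Import Order.TTheory GRing.Theory Num.Theory.
Local Open Scope ring_scope.

(** * Bit lengths of integers and of results of arithmetic operations *)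

Lemma bitlen_le (W : nat) (z : int) :
  (0 < W)%N -> (`|z| < 2 ^ W)%N -> (bitlen z <= W)%N.
Proof.
move=> W0 zW; rewrite /bitlen; have [->|z0] := posnP `|z|%N.
  by rewrite trunc_log0.
by rewrite -(ltn_exp2l _ _ (ltnSn 1)) (leq_ltn_trans _ zW) // trunc_logP.
Qed.

Lemma bitlen_lt (z : int) : (`|z| < 2 ^ bitlen z)%N.
Proof. exact: trunc_log_ltn. Qed.

Lemma bitlen_mono (a b : int) : (`|a| <= `|b|)%N -> (bitlen a <= bitlen b)%N.
Proof. by move=> ab; apply: bitlen_le => //; apply: leq_ltn_trans (bitlen_lt b). Qed.

(** Bit lengths are at least 1: with [|a| < 2A], [|b| < 2B] and [A, B >= 1], even the sum, at most
    [2A + 2B - 2], stays below [4AB]. A quotient is no larger than its dividend in absolute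
    value. *)
Lemma bitlen_bin (o : binop) (a b : int) :
  (bitlen (binop_eval o a b) <= bitlen a + bitlen b)%N.
Proof.
apply: bitlen_le => //.
have ha := bitlen_lt a; have hb := bitlen_lt b.
have pa : (0 < 2 ^ (trunc_log 2 `|a|))%N by rewrite expn_gt0.
have pb : (0 < 2 ^ (trunc_log 2 `|b|))%N by rewrite expn_gt0.
rewrite expnD.
have hs : (`|a| + `|b| < 2 ^ bitlen a * 2 ^ bitlen b)%N.
  by move: ha hb; rewrite /bitlen !expnS; nia.
case: o => /=.
- by apply: leq_ltn_trans hs; lia.
- by apply: leq_ltn_trans hs; lia.
- by rewrite abszM ltn_mul.
- apply: leq_ltn_trans hs; apply: leq_trans (leq_addr _ _).
  by have := lez_div a b; lia.
Qed.

(** * Hoare triples with a time budget *)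

Fixpoint leaves (e : expr) : nat :=
  if e is Bin _ e1 e2 then (leaves e1 + leaves e2)%N else 1%N.

(** The factor of [W] in the evaluation cost: a value built from [leaves e] words has at most
    [leaves e * W] bits, and each [Bin] node pays for its own result. *)
Fixpoint weighted_size (e : expr) : nat :=
  match e with
  | Cst _ => 1
  | Reg _ => 2
  | Bin _ e1 e2 => weighted_size e1 + weighted_size e2 + (leaves e1 + leaves e2)
  end%N.

Fixpoint small_leaves (e : expr) : bool :=
  match e with
  | Cst z => bitlen z <= 6
  | Reg x => bitlen x <= 6
  | Bin _ e1 e2 => small_leaves e1 && small_leaves e2
  end%N.

(** The constant 50 leaves room, within one step of cost [64 W], for a target register index and the
    value stored in it. *)
Definition cheap (e : expr) : bool :=
  (weighted_size e <= 50)%N && small_leaves e.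

Definition bounded (W : nat) (s : state) : Prop :=
  forall x, (bitlen (regs s x) <= W)%N.

Lemma ecost_le (W : nat) (s : state) (e : expr) :
  (6 <= W)%N -> bounded W s -> small_leaves e ->
  (ecost (regs s) e <= weighted_size e * W)%N /\
  (bitlen (eval (regs s) e) <= leaves e * W)%N.
Proof.
move=> W6 bs; elim: e => [z|x|o e1 IH1 e2 IH2] /=.
- by move=> h; split; lia.
- by move=> h; have := bs x; split; lia.
move=> /andP[/IH1[c1 b1] /IH2[c2 b2]].
have := bitlen_bin o (eval (regs s) e1) (eval (regs s) e2).
by split; lia.
Qed.

Lemma cheap_cost (W : nat) (s : state) (e : expr) :
  (6 <= W)%N -> bounded W s -> cheap e -> (ecost (regs s) e <= 50 * W)%N.
Proof.
move=> W6 bs /andP[we se]; have [h _] := ecost_le W6 bs se.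
by apply: leq_trans h _; rewrite leq_mul2r we orbT.
Qed.

(** * Registers and memory that a program leaves alone *)

Fixpoint modified (p : cmd) : seq nat :=
  match p with
  | Skip => [::]
  | Assign x _ => [:: x]
  | MemRead x _ => [:: x]
  | MemWrite _ _ => [::]
  | Seq p q => modified p ++ modified q
  | If _ p q => modified p ++ modified q
  | While _ p => modified p
  end.

Fixpoint read_only (p : cmd) : bool :=
  match p with
  | MemWrite _ _ => false
  | Seq p q => read_only p && read_only q
  | If _ p q => read_only p && read_only q
  | While _ p => read_only p
  | _ => true
  end.

Definition frame (p : cmd) (s s' : state) : Prop :=
  (forall x, x \notin modified p -> regs s' x = regs s x) /\
  (read_only p -> Defs.mem s' = Defs.mem s).

Lemma frame_trans (p : cmd) (s1 s2 s3 : state) :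
  frame p s1 s2 -> frame p s2 s3 -> frame p s1 s3.
Proof.
move=> [r1 m1] [r2 m2]; split=> [x xp|rp]; first by rewrite r2 // r1.
by rewrite m2 // m1.
Qed.

Lemma frame_sub (p q : cmd) (s s' : state) :
  {subset modified p <= modified q} -> (read_only q -> read_only p) ->
  frame p s s' -> frame q s s'.
Proof.
move=> sub ro [r m]; split=> [x xq|/ro/m //].
by apply: r; apply: contra xq; apply: sub.
Qed.

Lemma exec_frame (p : cmd) (s s' : state) (t : nat) :
  exec p s t s' -> frame p s s'.
Proof.
elim=> {p s t s'}.
- by [].
- by move=> s x e; split=> //= y; rewrite inE => /negbTE ->.
- by move=> s x e a _; split=> //= y; rewrite inE => /negbTE ->.
- by [].
- move=> s s1 s2 p1 p2 t1 t2 _ h1 _ h2.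
  apply: frame_trans (frame_sub _ _ h1) (frame_sub _ _ h2) => /=.
  + by move=> x xp; rewrite mem_cat xp.
  + by case/andP.
  + by move=> x xp; rewrite mem_cat xp orbT.
  + by case/andP.
- move=> s s1 e p1 p2 t _ _; apply: frame_sub => /=; last by case/andP.
  by move=> x xp; rewrite mem_cat xp.
- move=> s s1 e p1 p2 t _ _; apply: frame_sub => /=; last by case/andP.
  by move=> x xp; rewrite mem_cat xp orbT.
- by move=> s s1 s2 e p t1 t2 _ _ h1 _ h2; apply: frame_trans h2.
- by [].
Qed.

(* [run W p s u Q]: keeping all registers within [W] bits, [p] halts in a state
   satisfying [Q] after at most [u] elementary steps of cost at most [64 W]. *)
Definition run (W : nat) (p : cmd) (s : state) (u : nat) (Q : state -> Prop) :=
  exists (t : nat) (s' : state),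
    [/\ exec p s t s', (t <= u * (64 * W))%N, bounded W s' & Q s'].

Section Rules.
Context (W : nat) (W6 : (6 <= W)%N).
Implicit Types (p : cmd) (s : state) (e : expr) (Q : state -> Prop) (u : nat).

Lemma run_conseq p s u u' Q Q' :
  run W p s u Q -> (u <= u')%N ->
  (forall s', bounded W s' -> frame p s s' -> Q s' -> Q' s') ->
  run W p s u' Q'.
Proof.
move=> [t [s' [ex tu bs' Qs']]] uu QQ'; exists t, s'; split=> //.
  by apply: leq_trans tu _; rewrite leq_mul2r uu orbT.
by apply: QQ' => //; apply: exec_frame ex.
Qed.

Lemma run_le p s u u' Q : (u <= u')%N -> run W p s u Q -> run W p s u' Q.
Proof. by move=> uu h; apply: run_conseq h uu _. Qed.

(** The postcondition of [p] is itself a run of [q], so a proof executes a program one instruction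
    after the other. *)
Lemma run_seq p q s u v Q :
  run W p s u (fun s' => bounded W s' -> run W q s' v Q) ->
  run W (Seq p q) s (u + v) Q.
Proof.
move=> [t [s' [ex tu bs' /(_ bs')]]] [t2 [s2 [ex2 tu2 bs2 Qs2]]].
exists (t + t2)%N, s2; split=> //; first exact: exec_seq ex ex2.
by rewrite mulnDl leq_add.
Qed.

Lemma bounded_set_reg s (x : nat) v :
  bounded W s -> (bitlen v <= W)%N -> bounded W (set_reg s x v).
Proof. by move=> bs vW y /=; case: ifP. Qed.

Lemma run_assign (x : nat) e s Q :
  bounded W s -> cheap e -> (bitlen x <= 6)%N ->
  (bitlen (eval (regs s) e) <= W)%N ->
  Q (set_reg s x (eval (regs s) e)) -> run W (Assign x e) s 1 Q.
Proof.
move=> bs ce x6 vW Qs; eexists; eexists; split; [exact: exec_assign | | |] => //.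
  by have := cheap_cost W6 bs ce; lia.
exact: bounded_set_reg.
Qed.

Lemma run_read (x : nat) e (a : nat) s Q :
  bounded W s -> cheap e -> (bitlen x <= 6)%N -> eval (regs s) e = a ->
  (bitlen (Defs.mem s a) <= W)%N ->
  Q (set_reg s x (Defs.mem s a)) -> run W (MemRead x e) s 1 Q.
Proof.
move=> bs ce x6 ea vW Qs; eexists; eexists; split; [exact: exec_read ea | | |] => //.
  by have := cheap_cost W6 bs ce; lia.
exact: bounded_set_reg.
Qed.

Lemma run_write e1 e2 (a : nat) s Q :
  bounded W s -> cheap e1 -> cheap e2 -> eval (regs s) e1 = a ->
  Q (set_mem s a (eval (regs s) e2)) -> run W (MemWrite e1 e2) s 2 Q.
Proof.
move=> bs c1 c2 ea Qs; eexists; eexists; split; [exact: exec_write ea | | |] => //.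
by have := cheap_cost W6 bs c1; have := cheap_cost W6 bs c2; lia.
Qed.

End Rules.

Definition For (i m : nat) (body : cmd) : cmd :=
  Seq (Assign i (Cst 0))
    (While (Bin Defs.Sub (Reg m) (Reg i))
      (Seq body (Assign i (Bin Add (Reg i) (Cst 1))))).

(** In each round [+ 2] pays for the test and the increment; the last [+ 2] pays for the
    initialisation and the failing test. [I] has to survive changes of the counter, since the
    increment follows the body. The frame handed to the body keeps facts about untouched registers
    out of [I]. *)
Lemma run_for (W i m M u : nat) (body : cmd) (s : state)
    (I : nat -> state -> Prop) (Q : state -> Prop) :
  (6 <= W)%N -> (bitlen i <= 6)%N -> (bitlen m <= 6)%N ->
  i != m -> i \notin modified body -> m \notin modified body ->
  bounded W s -> regs s m = M ->
  I 0%N s ->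
  (forall j s' v, I j s' -> I j (set_reg s' i v)) ->
  (forall j s', (j < M)%N -> bounded W s' -> frame (For i m body) s s' ->
     regs s' i = j -> I j s' -> run W body s' u (I j.+1)) ->
  (forall s', bounded W s' -> frame (For i m body) s s' -> I M s' -> Q s') ->
  run W (For i m body) s (M * (u + 2) + 2) Q.
Proof.
move=> W6 i6 m6 im imod mmod bs sm I0 Ii step post.
have ML : (bitlen M <= W)%N by rewrite -sm; apply: bs.
have jL j : (j <= M)%N -> (bitlen j <= W)%N.
  move=> jM; apply: bitlen_le; first by lia.
  by apply: leq_ltn_trans (leq_trans (bitlen_lt M) _) => //; rewrite leq_exp2l.
have cm : cheap (Bin Defs.Sub (Reg m) (Reg i)) by rewrite /cheap /= m6 i6.
have ci : cheap (Bin Add (Reg i) (Cst 1)) by rewrite /cheap /= i6.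
have frame_post s' : frame (For i m body) s s' -> regs s' m = M.
  by move=> [fr _]; rewrite fr //= !(inE, mem_cat) eq_sym (negbTE im) (negbTE mmod).
(* Induction on the number [d] of rounds left. *)
have loop d : forall j s', (j + d = M)%N -> bounded W s' ->
    frame (For i m body) s s' -> regs s' i = j -> I j s' ->
    run W (While (Bin Defs.Sub (Reg m) (Reg i))
      (Seq body (Assign i (Bin Add (Reg i) (Cst 1))))) s' (d * (u + 2) + 1) Q.
  elim: d => [|d IH] j s' jd bs' fr s'i Ij.
    have ev : eval (regs s') (Bin Defs.Sub (Reg m) (Reg i)) <= 0.
      by rewrite /= (frame_post _ fr) s'i; lia.
    eexists; eexists; split; [exact: exec_while_false ev | | exact: bs' |].
      by have := cheap_cost W6 bs' cm; lia.
    by apply: post => //; rewrite -jd addn0.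
  have ev : 0 < eval (regs s') (Bin Defs.Sub (Reg m) (Reg i)).
    by rewrite /= (frame_post _ fr) s'i; lia.
  have jM : (j < M)%N by lia.
  have [t [s1 [ex tu bs1 Is1]]] := step j s' jM bs' fr s'i Ij.
  have fr1 := exec_frame ex.
  have s1i : regs s1 i = j by rewrite fr1.1.
  have ei : eval (regs s1) (Bin Add (Reg i) (Cst 1)) = j.+1 :> int.
    by rewrite /= s1i; lia.
  have [|||||t2 [s2 [ex2 tu2 bs2 Qs2]]] :=
      IH j.+1 (set_reg s1 i j.+1).
  - by rewrite addSnnS.
  - by apply: bounded_set_reg => //; apply: jL; lia.
  - apply: frame_trans (frame_trans fr (frame_sub _ _ fr1)) _ => /=.
    + by move=> x xp; rewrite !(inE, mem_cat) xp orbT.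
    + by case/andP.
    + by split=> // x /=; rewrite inE negb_or => /andP[/negbTE ->].
  - by rewrite /= eqxx.
  - exact: Ii.
  eexists; eexists; split; [ | | exact: bs2 | exact: Qs2].
    apply: exec_while_true ev (exec_seq ex (exec_assign _ _ _)) _.
    by rewrite ei; exact: ex2.
  rewrite ei.
  have := cheap_cost W6 bs' cm; have := cheap_cost W6 bs1 ci.
  have := jL _ jM.
  nia.
rewrite /For.
rewrite (_ : _ + _ = 1 + (M * (u + 2) + 1))%N; last by lia.
apply: run_seq; apply: run_assign => //.
  exact: (jL 0%N).
move=> bs0; apply: (loop M 0%N) => //.
- by split=> // x /=; rewrite inE negb_or => /andP[/negbTE ->].
- by rewrite /= eqxx.
- exact: Ii.
Qed.

(** * Sums over digits *)

Lemma sum_divmod (m q : nat) (F : nat -> nat -> nat) : (0 < q)%N ->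
  (\sum_(0 <= z < m * q) F (z %/ q) (z %% q) =
   \sum_(0 <= x < m) \sum_(0 <= c < q) F x c)%N.
Proof.
move=> q0; elim: m => [|m IH]; first by rewrite !big_geq.
rewrite big_nat_recr //= -IH mulSnr (big_cat_nat _ (n := (m * q)%N)) ?leq_addr //=.
congr addn; rewrite -{1}[(m * q)%N]add0n big_addn addKn big_nat [RHS]big_nat.
apply: eq_bigr => c /andP[_ cq].
by rewrite addnC divnMDl // modnMDl divn_small // modn_small // addn0.
Qed.

Lemma digit_mod (L c i k : nat) : (0 < L)%N -> (i < k)%N ->
  (((c %% L ^ k) %/ L ^ i) %% L = (c %/ L ^ i) %% L)%N.
Proof.
move=> L0 ik; rewrite [in RHS](divn_eq c (L ^ k)).
have -> : (L ^ k = L ^ (k - i.+1) * L * L ^ i)%N.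
  by rewrite -mulnA -expnS -expnD; congr (_ ^ _)%N; lia.
by rewrite mulnA divnMDl ?expn_gt0 ?L0 // mulnA modnMDl.
Qed.

Lemma digit_div (L c i k : nat) :
  (((c %/ L ^ k) %/ L ^ i) %% L = (c %/ L ^ (k + i)) %% L)%N.
Proof. by rewrite -divnMA -expnD. Qed.

(** Expanding the product of sums gives one term for each tuple in [[L]^k], and the tuples are the
    base-[L] digit strings of the numbers [c]. *)
Lemma sum_prod_digits (L k : nat) (F : nat -> nat -> nat) : (0 < L)%N ->
  (\sum_(0 <= c < L ^ k) \prod_(0 <= i < k) F i ((c %/ L ^ i) %% L) =
   \prod_(0 <= i < k) \sum_(0 <= l < L) F i l)%N.
Proof.
move=> L0; elim: k => [|k IH].
  by rewrite expn0 big_nat1 !big_geq.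
rewrite [RHS]big_nat_recr //= -IH mulnC big_distrl /= expnS.
under [RHS]eq_bigr do rewrite big_distrr /=.
(* [x] is the leading digit of a number below [L ^ k.+1], and [c] is the rest. *)
pose G x c := (F k x * \prod_(0 <= i < k) F i ((c %/ L ^ i) %% L))%N.
rewrite -(sum_divmod L G); last by rewrite expn_gt0 L0.
rewrite big_nat [RHS]big_nat; apply: eq_bigr => c /andP[_ cL].
rewrite big_nat_recr //= mulnC; congr (F k _ * _)%N.
  by rewrite modn_small // ltn_divLR ?expn_gt0 ?L0.
rewrite big_nat [RHS]big_nat; apply: eq_bigr => i /andP[_ ik].
by rewrite digit_mod.
Qed.

(* [v < u] iff [u] and [v] first differ, from the top, at a bit set in [u];
   that position [l] is unique. *)
Lemma ltn_bits (L u v : nat) : (u < 2 ^ L)%N -> (v < 2 ^ L)%N ->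
  (\sum_(0 <= l < L)
     (u %/ 2 ^ l == (v %/ 2 ^ l).+1) * ((u %/ 2 ^ l) %% 2) = (v < u))%N.
Proof.
elim: L u v => [|L IH] u v; first by rewrite big_geq //; case: u v => [|?] [|?].
rewrite expnS => uL vL; rewrite big_nat_recl // !expn0 !divn1.
under eq_bigr do rewrite expnS !divnMA.
rewrite IH; try by rewrite ltn_divLR // mulnC.
(* If [u = v + 1], level 0 counts when [u] is odd and a higher level when [u] is even, never both.
   Otherwise [v < u] iff [v %/ 2 < u %/ 2]. *)
case: eqP => [->|uv]; first by case: ltnP => h; lia.
by rewrite mul0n add0n; congr nat_of_bool; apply/idP/idP; lia.
Qed.

Lemma bits_inj (n z z' : nat) : (z < 2 ^ n)%N -> (z' < 2 ^ n)%N ->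
  (forall j, (j < n)%N -> odd (z %/ 2 ^ j) = odd (z' %/ 2 ^ j)) -> z = z'.
Proof.
elim: n z z' => [|n IH] z z'; first by case: z z' => [|?] [|?].
rewrite expnS => zn zn' h.
have h0 : odd z = odd z' by have := h 0%N isT; rewrite expn0 !divn1.
have h1 : (z %/ 2 = z' %/ 2)%N.
  apply: IH; rewrite ?ltn_divLR // 1?mulnC // => j jn.
  by have := h j.+1 jn; rewrite expnS !divnMA.
by lia.
Qed.

(** Reading off binary digits is an injection between finite sets of equal size, hence a
    reindexing. *)
Lemma sum_ffun_bits (n : nat) (G : {ffun 'I_n -> bool} -> nat) :
  (\sum_x G x = \sum_(0 <= z < 2 ^ n) G [ffun j : 'I_n => odd (z %/ 2 ^ j)])%N.
Proof.
rewrite big_mkord.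
pose g (z : 'I_(2 ^ n)) := [ffun j : 'I_n => odd (z %/ 2 ^ j)].
have g_inj : injective g.
  move=> z z' /ffunP gz; apply/val_inj/(bits_inj (ltn_ord z) (ltn_ord z')) => j jn.
  by have := gz (Ordinal jn); rewrite !ffunE.
rewrite (reindex g) //; apply: onW_bij; apply: inj_card_bij => //.
by rewrite card_ffun card_bool !card_ord.
Qed.

Lemma eqn_divmod (q a a' d d' : nat) : (d < q)%N -> (d' < q)%N ->
  (a * q + d == a' * q + d')%N = (a == a') && (d == d').
Proof.
move=> dq dq'; apply/eqP/andP => [e|[/eqP -> /eqP -> //]].
have q0 : (0 < q)%N by apply: leq_ltn_trans dq.
have := congr1 (divn^~ q) e; have := congr1 (modn^~ q) e.
by rewrite !modnMDl !divnMDl // !modn_small // !divn_small // !addn0 => -> ->.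
Qed.

Lemma sum_indicator (m c : nat) (G : nat -> nat) : (c < m)%N ->
  (\sum_(0 <= i < m) (i == c) * G i = G c)%N.
Proof.
move=> cm; rewrite big_mkord (bigD1 (Ordinal cm)) //= eqxx mul1n big1 ?addn0 //.
by move=> i; rewrite -val_eqE /= => /negbTE ->.
Qed.

(** * The program *)

Declare Scope expr_scope.
Delimit Scope expr_scope with expr.
Notation "a + b" := (Bin Add a b) : expr_scope.
Notation "a - b" := (Bin Defs.Sub a b) : expr_scope.
Notation "a * b" := (Bin Mul a b) : expr_scope.
Notation "a / b" := (Bin Div a b) : expr_scope.
Notation "x <- e" := (Assign x e%expr) (at level 55, e at level 54).
Notation "x <- 'M[' e ]" :=
  (MemRead x e%expr) (at level 55, format "x  <-  'M[' e ]").
Notation "p ;; q" := (Seq p q) (at level 60, right associativity).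

(** Indices below 64 cost at most 6 bits. Registers 1 to 6 keep their values through both passes; 7
    and 8 are set at the start of each pass. *)
Notation rTotal := 0%N (only parsing).
Notation rN := 1%N (only parsing).
Notation rK := 2%N (only parsing).
Notation rL := 3%N (only parsing).
Notation rQ := 4%N (only parsing).
Notation rP := 5%N (only parsing).
Notation rC := 6%N (only parsing).
Notation rOff := 7%N (only parsing).
Notation rCnt := 8%N (only parsing).
Notation rZn := 9%N (only parsing).
Notation rz := 10%N (only parsing).
Notation rx := 11%N (only parsing).
Notation rd := 12%N (only parsing).
Notation rkey := 13%N (only parsing).
Notation rwt := 14%N (only parsing).
Notation ri := 15%N (only parsing).
Notation rv := 16%N (only parsing).
Notation ry := 17%N (only parsing).
Notation rj := 18%N (only parsing).
Notation rw := 19%N (only parsing).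
Notation rl := 20%N (only parsing).
Notation rq := 21%N (only parsing).
Notation rm := 22%N (only parsing).

Definition int_of_bool (b : bool) : int := (b : nat).

Definition sign_of (b : bool) : int := if b then -1 else 1.

(* In [value_cmd] to [phase_cmd], [b = false] treats the left half of the
   variables and fills the table; [b = true] treats the right half and queries
   it. *)
Definition value_cmd (b : bool) : cmd :=
  rv <- M[Cst 2 + Reg ri * (Reg rN + Cst 1) + Reg rN] ;;
  rv <- Reg rQ + Cst (int_of_bool b) * (Reg rv - Cst 1) ;;
  ry <- Reg rx ;;
  For rj rCnt
    (rw <- M[Cst 2 + Reg ri * (Reg rN + Cst 1) + (Reg rOff + Reg rj)] ;;
     rv <- Reg rv +
       Cst (sign_of b) * (Reg rw * (Reg ry - (Reg ry / Cst 2) * Cst 2)) ;;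
     ry <- Reg ry / Cst 2).

(** [rl] is the next base-[L] digit of the tuple index. Halving [rl] times divides by [2 ^ rl], and
    [rl < L] keeps this polynomial. *)
Definition digit_cmd (b : bool) : cmd :=
  rl <- Reg rd - (Reg rd / Reg rL) * Reg rL ;;
  rd <- Reg rd / Reg rL ;;
  For rq rl (rv <- Reg rv / Cst 2) ;;
  rwt <- Reg rwt * (Reg rv - (Reg rv / Cst 2) * Cst 2) ;;
  rkey <- Reg rkey * Reg rP + (Reg rv + Cst (int_of_bool b)).

(** The counter [rz] packs a half assignment and a tuple index into one number. Adding
    [2 + k (n + 1)] moves the table behind the input. *)
Definition key_cmd (b : bool) : cmd :=
  rx <- Reg rz / Reg rC ;;
  rd <- Reg rz - Reg rx * Reg rC ;;
  rkey <- Reg rd ;;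
  rwt <- Cst 1 ;;
  For ri rK (value_cmd b ;; digit_cmd b) ;;
  rkey <- Cst 2 + Reg rK * (Reg rN + Cst 1) + Reg rkey ;;
  rm <- M[Reg rkey].

Definition table_cmd (b : bool) : cmd :=
  if b then rTotal <- Reg rTotal + Reg rm
  else MemWrite (Reg rkey) (Reg rm + Reg rwt)%expr.

Definition phase_cmd (b : bool) : cmd :=
  rOff <- Cst (int_of_bool b) * (Reg rN / Cst 2) ;;
  rCnt <- Cst (int_of_bool b) * Reg rN + Cst (sign_of b) * (Reg rN / Cst 2) ;;
  rZn <- Reg rC ;;
  For rj rCnt (rZn <- Reg rZn + Reg rZn) ;;
  For rz rZn (key_cmd b ;; table_cmd b).

Definition main_cmd : cmd :=
  rN <- M[Cst 0] ;;
  rK <- M[Cst 1] ;;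
  rL <- Reg rN * Reg rN + Reg rN + Cst 2 ;;
  rQ <- Cst 1 ;;
  rCnt <- Reg rN * Reg rN + Reg rN ;;
  For rj rCnt (rQ <- Reg rQ + Reg rQ) ;;
  rP <- Cst 8 * Reg rQ ;;
  rC <- Cst 1 ;;
  For rj rK (rC <- Reg rC * Reg rL) ;;
  phase_cmd false ;;
  phase_cmd true.

(** * Counting through the table *)

Section Algorithm.
Context (n k : nat) (inp : nat -> int).

(** Number of bit levels: values are at most [2 * offset = 2 ^ (nlev - 1)]. *)
Definition nlev : nat := (n * n + n + 2)%N.
(** At least [(n + 2) * n ^ n]: [n * n ^ n] covers a partial sum and [2 * n ^ n] the threshold minus
    1. A power of two is obtained by doublings. *)
Definition offset : nat := (2 ^ (n * n + n))%N.
(** Exceeds every digit of a code, these being at most [2 * offset + 1]. *)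
Definition radix : nat := (8 * offset)%N.
Definition ntup : nat := (nlev ^ k)%N.
Definition base : nat := (2 + k * (n + 1))%N.
Definition width (b : bool) : nat := if b then (n - n %/ 2)%N else (n %/ 2)%N.
Definition start (b : bool) : nat := if b then (n %/ 2)%N else 0%N.
(** A row holds [n] weights followed by the threshold, so [coef i n] is the threshold. *)
Definition coef (i j : nat) : int := inp (2 + i * (n + 1) + j)%N.
Definition bit (x j : nat) : nat := ((x %/ 2 ^ j) %% 2)%N.

(* Up to the common [offset], which makes it nonnegative, this is the sum of the
   left half if [b = false], and the threshold minus 1 minus the sum of the right
   half if [b = true] (for [m = width b]). *)
Definition side (b : bool) (x i m : nat) : int :=
  offset%:Z + int_of_bool b * (coef i n - 1)
  + \sum_(0 <= j < m) sign_of b * (coef i (start b + j) * (bit x j)%:Z).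

Definition value (b : bool) (x i : nat) : nat := `|side b x i (width b)|%N.
Definition level (c i : nat) : nat := ((c %/ nlev ^ i) %% nlev)%N.
Definition shifted (b : bool) (x c i : nat) : nat :=
  (value b x i %/ 2 ^ level c i)%N.

(* Adding [b] to each digit turns the matching condition
   [shifted false = (shifted true).+1] into equality of codes; the leading digit
   [c] separates the tables of different level tuples. *)
Fixpoint code (b : bool) (x c m : nat) : nat :=
  if m is m'.+1 then (code b x c m' * radix + (shifted b x c m' + b))%N else c.

(* The weight with which the left half enters the table. *)
Definition parity (b : bool) (x c m : nat) : nat :=
  (\prod_(0 <= i < m) (shifted b x c i %% 2))%N.

Definition address (b : bool) (z : nat) : nat :=
  (base + code b (z %/ ntup) (z %% ntup) k)%N.

Definition pair_parity (b : bool) (z : nat) : nat :=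
  parity b (z %/ ntup) (z %% ntup) k.

Definition npairs (b : bool) : nat := (ntup * 2 ^ width b)%N.

(** Content of table cell [a] once the first [m] pairs of the left half have been entered. *)
Definition entry (m a : nat) : nat :=
  (\sum_(0 <= z < m) (address false z == a) * pair_parity false z)%N.

(** Running total after [m] queries to the completed table. *)
Definition matches (m : nat) : nat :=
  (\sum_(0 <= z < m) entry (npairs false) (address true z))%N.

Lemma width_le b : (width b <= n)%N.
Proof. by rewrite /width; case: b; lia. Qed.

Lemma start_width b : (start b + width b <= n)%N.
Proof. by rewrite /width /start; case: b; lia. Qed.

Lemma radix_gt0 : (0 < radix)%N.
Proof. by rewrite /radix muln_gt0 expn_gt0. Qed.

Lemma ntup_gt0 : (0 < ntup)%N.
Proof. by rewrite expn_gt0 /nlev addn2. Qed.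

Lemma npairs_gt0 b : (0 < npairs b)%N.
Proof. by rewrite /npairs muln_gt0 ntup_gt0 expn_gt0. Qed.

Lemma npairs_mul : (npairs true * npairs false = 2 ^ n * ntup * ntup)%N.
Proof.
have -> : (2 ^ n = 2 ^ width true * 2 ^ width false)%N.
  by rewrite -expnD; congr (2 ^ _)%N; rewrite /width; lia.
by rewrite /npairs; lia.
Qed.

Lemma parity_le1 b x c m : (parity b x c m <= 1)%N.
Proof.
rewrite /parity; elim: m => [|m IH]; first by rewrite big_geq.
rewrite big_nat_recr //=.
by rewrite -[1%N]/(1 * 1)%N leq_mul // -ltnS ltn_pmod.
Qed.

Lemma entry_le m a : (entry m a <= m)%N.
Proof.
rewrite /entry -[leqRHS]subn0 -[leqRHS]muln1 -sum_nat_const_nat.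
apply: leq_sum => z _; rewrite -[1%N]/(1 * 1)%N.
by rewrite leq_mul ?leq_b1 // parity_le1.
Qed.

(** Table addresses start at [base], so filling the table never disturbs the input. *)
Lemma entry_base m a : (a < base)%N -> entry m a = 0%N.
Proof.
move=> ab; rewrite /entry big1 // => z _.
by rewrite [_ == a]gtn_eqF // /address ltn_addr.
Qed.

Lemma sum_half (F : nat -> int) :
  \sum_(0 <= j < n) F j = \sum_(0 <= j < width false) F (start false + j)%N +
    \sum_(0 <= j < width true) F (start true + j)%N.
Proof.
rewrite /width /start (big_cat_nat _ (n := (n %/ 2)%N)) ?leq_div //=.
congr (_ + _).
rewrite -{1}[(n %/ 2)%N]add0n big_addn.
by apply: eq_bigr => j _; rewrite addnC.
Qed.

Hypothesis n2 : (2 <= n)%N.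

Lemma nlev_ge : (8 <= nlev)%N.
Proof. by rewrite /nlev; nia. Qed.

Lemma offset_ge : ((n + 2) * n ^ n <= offset)%N.
Proof.
(* This is [n + 2 <= 2 ^ n] for [n >= 2], with [d = n - 2]. *)
have n_lt : forall d, ((d + 2) + 2 <= 2 ^ (d + 2))%N.
  by elim=> [|d IH] //; rewrite addSn expnS; lia.
rewrite /offset (addnC (n * n)%N) expnD expnM leq_mul //.
  by have := n_lt (n - 2)%N; rewrite subnK.
by rewrite leq_exp2r; [exact: ltnW (ltn_expl _ _) | lia].
Qed.

Hypothesis coef_le : forall i j, (i < k)%N -> (j <= n)%N ->
  (`|coef i j| <= n ^ n)%N.

(** Partial sums, with [m] below [width b], are covered because [rv] runs through all of them. *)
Lemma side_bounds b x i m : (i < k)%N -> (m <= width b)%N ->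
  0 <= side b x i m <= 2 * offset%:Z.
Proof.
move=> ik mw.
have b_le j : (bit x j <= 1)%N by rewrite /bit; lia.
have hs : `|\sum_(0 <= j < m)
    sign_of b * (coef i (start b + j) * (bit x j)%:Z)| <= (m * n ^ n)%N%:Z.
  elim: m mw => [|m IH] mw; first by rewrite big_geq.
  rewrite big_nat_recr //= mulSnr PoszD.
  apply: le_trans (ler_normD _ _) _; apply: lerD; first by apply: IH; lia.
  have jn : (start b + m <= n)%N by have := start_width b; lia.
  have := coef_le ik jn; have := b_le m; rewrite /sign_of.
  by case: (bit x m) => [|[|//]] _; case: (b); lia.
have mn : (m * n ^ n <= n * n ^ n)%N.
  by rewrite leq_mul2r (leq_trans mw (width_le b)) orbT.
have n0 : (0 < n ^ n)%N by rewrite expn_gt0; lia.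
have := coef_le ik (leqnn n); have := offset_ge; move: hs.
rewrite /side /int_of_bool mulnDl.
by case: (b) => /=; lia.
Qed.

Lemma value_le b x i : (i < k)%N -> (value b x i <= 2 * offset)%N.
Proof.
by move=> ik; have := side_bounds x ik (leqnn (width b)); rewrite /value; lia.
Qed.

Lemma shifted_lt b x c i : (i < k)%N -> (shifted b x c i + b < radix)%N.
Proof.
move=> ik; have := value_le b x ik.
have := leq_div (value b x i) (2 ^ level c i).
have : (0 < offset)%N by rewrite expn_gt0.
by rewrite /shifted /radix; case: (b); lia.
Qed.

Lemma code_lt b x c m : (c < ntup)%N -> (m <= k)%N ->
  (code b x c m < ntup * radix ^ m)%N.
Proof.
move=> cn; elim: m => [|m IH] mk /=; first by rewrite muln1.
have := IH (ltnW mk); have := shifted_lt b x c mk.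
rewrite expnSr mulnA => pl cl; apply: leq_trans (leq_mul cl (leqnn radix)).
by rewrite mulSn; lia.
Qed.

(** All digits are below [radix], so equal codes agree in the leading digit and in every later
    one. *)
Lemma code_eq x0 x1 c0 c1 m : (m <= k)%N ->
  ((code false x0 c0 m == code true x1 c1 m) =
   (c0 == c1) *
   \prod_(0 <= i < m) (shifted false x0 c0 i == (shifted true x1 c1 i).+1)
   :> nat)%N.
Proof.
elim: m => [|m IH] mk /=; first by rewrite big_geq // muln1.
rewrite eqn_divmod ?(shifted_lt false) ?(shifted_lt true) //.
rewrite big_nat_recr //= mulnA -IH; last exact: ltnW.
by rewrite addn0 addn1 -mulnb.
Qed.

Lemma value_lt_nlev b x i : (i < k)%N -> (value b x i < 2 ^ nlev)%N.
Proof.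
move=> ik; apply: leq_ltn_trans (value_le b x ik) _.
have : (0 < offset)%N by rewrite expn_gt0.
by rewrite /nlev expnD -/offset; lia.
Qed.

(** Equal codes force [c0 = c1]. The sum over the common tuple factors into one sum over levels for
    each [i], which [ltn_bits] evaluates as a comparison. *)
Lemma sum_levels x0 x1 :
  (\sum_(0 <= c1 < ntup) \sum_(0 <= c0 < ntup)
     (code false x0 c0 k == code true x1 c1 k) * parity false x0 c0 k =
   \prod_(0 <= i < k) (value true x1 i < value false x0 i))%N.
Proof.
pose T i l := ((value false x0 i %/ 2 ^ l == (value true x1 i %/ 2 ^ l).+1) *
  ((value false x0 i %/ 2 ^ l) %% 2))%N.
transitivity (\sum_(0 <= c < ntup) \prod_(0 <= i < k) T i (level c i))%N.
  rewrite big_nat [RHS]big_nat; apply: eq_bigr => c /andP[_ cn].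
  under eq_bigr do rewrite code_eq // -mulnA.
  by rewrite sum_indicator // -big_split.
rewrite sum_prod_digits ?(ltn_trans _ nlev_ge) //.
rewrite big_nat [RHS]big_nat; apply: eq_bigr => i /andP[_ ik].
by rewrite ltn_bits // value_lt_nlev.
Qed.

(** The low bits of [z] give the left half, with sum [S0], the high bits the right half, with sum
    [S1]. The offset cancels, and [S0 > t - 1 - S1] means [S0 + S1 >= t]. *)
Lemma value_ltE x0 x1 z i : (i < k)%N ->
  x0 = (z %% 2 ^ width false)%N -> x1 = (z %/ 2 ^ width false)%N ->
  (value true x1 i < value false x0 i)%N =
  (coef i n <= \sum_(0 <= j < n) coef i j * (bit z j)%:Z).
Proof.
move=> ik e0 e1; rewrite sum_half.
have b0 : \sum_(0 <= j < width false)
     coef i (start false + j) * (bit z (start false + j))%:Z =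
   \sum_(0 <= j < width false) coef i (start false + j) * (bit x0 j)%:Z.
  rewrite big_nat [RHS]big_nat; apply: eq_bigr => j /andP[_ jw].
  by rewrite /bit e0 digit_mod.
have b1 : \sum_(0 <= j < width true)
     coef i (start true + j) * (bit z (start true + j))%:Z =
   \sum_(0 <= j < width true) coef i (start true + j) * (bit x1 j)%:Z.
  by apply: eq_bigr => j _; rewrite /bit e1 digit_div.
rewrite b0 b1.
have h0 := side_bounds x0 ik (leqnn (width false)).
have h1 := side_bounds x1 ik (leqnn (width true)).
have eq0 : side false x0 i (width false) = offset%:Z +
    \sum_(0 <= j < width false) coef i (start false + j) * (bit x0 j)%:Z.
  rewrite /side mul0r addr0; congr (_ + _).
  by apply: eq_bigr => j _; rewrite mul1r.
have eq1 : side true x1 i (width true) = offset%:Z + (coef i n - 1) -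
    \sum_(0 <= j < width true) coef i (start true + j) * (bit x1 j)%:Z.
  rewrite /side mul1r; congr (_ + _).
  by rewrite -sumrN; apply: eq_bigr => j _; rewrite mulN1r.
move: h0 h1; rewrite /value eq0 eq1.
set A := \sum_(_ <= _ < _) _; set B := \sum_(_ <= _ < _) _.
by move=> h0 h1; apply/idP/idP; lia.
Qed.

(** Both pair indices are split into half assignment and tuple; [sum_levels] sums out the tuples,
    and the two halves are glued into one [z < 2 ^ n]. *)
Lemma matches_eq :
  matches (npairs true) =
  (\sum_(0 <= z < 2 ^ n) \prod_(0 <= i < k)
     (coef i n <= \sum_(0 <= j < n) coef i j * (bit z j)%:Z)%R)%N.
Proof.
have nC b : npairs b = (2 ^ width b * ntup)%N by rewrite /npairs mulnC.
have c0 := ntup_gt0.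
pose F0 x1 c1 x0 c0 :=
  ((code false x0 c0 k == code true x1 c1 k) * parity false x0 c0 k)%N.
have cE z : entry (npairs false) (address true z) =
    (\sum_(0 <= x0 < 2 ^ width false) \sum_(0 <= c0 < ntup)
       F0 (z %/ ntup) (z %% ntup) x0 c0)%N.
  rewrite -sum_divmod // /entry nC; apply: eq_bigr => y _.
  by rewrite /address eqn_add2l.
rewrite /matches nC; under eq_bigr do rewrite cE.
rewrite (sum_divmod _ (fun x1 c1 => \sum_(0 <= x0 < 2 ^ width false)
  \sum_(0 <= c0 < ntup) F0 x1 c1 x0 c0)%N) //.
have -> : (2 ^ n = 2 ^ width true * 2 ^ width false)%N.
  by rewrite -expnD; congr (2 ^ _)%N; rewrite /width; lia.
pose G x1 x0 := (\prod_(0 <= i < k) (value true x1 i < value false x0 i))%N.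
transitivity (\sum_(0 <= x1 < 2 ^ width true) \sum_(0 <= x0 < 2 ^ width false)
  G x1 x0)%N.
  apply: eq_bigr => x1 _; rewrite exchange_big /=.
  by apply: eq_bigr => x0 _; rewrite sum_levels.
rewrite -sum_divmod ?expn_gt0 //; apply: eq_bigr => z _.
rewrite /G big_nat [RHS]big_nat; apply: eq_bigr => i /andP[_ ik].
by congr nat_of_bool; apply: value_ltE.
Qed.

(** * Correctness of the program *)

Context (W : nat).
Hypothesis k1 : (1 <= k)%N.
Hypothesis W6 : (6 <= W)%N.
(** The first bound makes all table addresses fit into [W] bits, the second all table entries and
    the running total. *)
Hypothesis W_base : (base + ntup * radix ^ k < 2 ^ W)%N.
Hypothesis W_total : (2 ^ n * ntup * ntup < 2 ^ W)%N.

Lemma nlev_le : (nlev <= ntup)%N.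
Proof.
by rewrite /ntup -[leqLHS]expn1 leq_pexp2l // /nlev addn2.
Qed.

Lemma ntup_lt : (ntup < 2 ^ W)%N.
Proof.
apply: leq_ltn_trans W_base; apply: leq_trans (leq_addl _ _).
by rewrite leq_pmulr // expn_gt0 radix_gt0.
Qed.

Lemma base_lt : (base < 2 ^ W)%N.
Proof. exact: leq_ltn_trans (leq_addr _ _) W_base. Qed.

Lemma bitlen_nat (m p : nat) : (m <= p)%N -> (p < 2 ^ W)%N -> (bitlen m <= W)%N.
Proof.
move=> mp pW; apply: bitlen_le; first by lia.
exact: leq_ltn_trans pW.
Qed.

(** What holds throughout pass [b]: the parameters in registers 1 to 8 and the coefficients in the
    input area. *)
Record env (b : bool) (s : state) : Prop := Env {
  envN : regs s rN = n;
  envK : regs s rK = k;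
  envL : regs s rL = nlev;
  envQ : regs s rQ = offset;
  envP : regs s rP = radix;
  envC : regs s rC = ntup;
  envOff : regs s rOff = start b;
  envCnt : regs s rCnt = width b;
  env_coef : forall i j, (i < k)%N -> (j <= n)%N ->
    Defs.mem s (2 + i * (n + 1) + j)%N = coef i j }.

Lemma env_frame b p s s' :
  ~~ has (fun x => x \in iota 1 8) (modified p) -> read_only p ->
  frame p s s' -> env b s -> env b s'.
Proof.
move=> /hasPn np rp [fr fm] [] *.
split; try by rewrite fr //; apply/negP => /np.
by move=> i j ik jn; rewrite fm //; auto.
Qed.

Lemma offset_bitlen : (2 * offset < 2 ^ W)%N.
Proof.
apply: leq_ltn_trans W_base; apply: leq_trans (leq_addl _ _).
have : (0 < ntup)%N by rewrite expn_gt0 /nlev addn2.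
have : (radix ^ 1 <= radix ^ k)%N.
  by rewrite leq_pexp2l // /radix muln_gt0 expn_gt0.
by rewrite expn1 /radix; nia.
Qed.

Lemma coef_bitlen i j : (i < k)%N -> (j <= n)%N -> (bitlen (coef i j) <= W)%N.
Proof.
move=> ik jn; apply: bitlen_le; first by lia.
by have := coef_le ik jn; have := offset_bitlen; have := offset_ge; nia.
Qed.

Lemma side_bitlen b x i m : (i < k)%N -> (m <= width b)%N ->
  (bitlen (side b x i m) <= W)%N.
Proof.
move=> ik mw; apply: bitlen_le; first by lia.
by have := side_bounds x ik mw; have := offset_bitlen; lia.
Qed.

(** The budget mirrors the shape of the program, so that [run_seq] and [run_for] apply directly;
    [run_row] simplifies it later. *)
Lemma run_value b s (x i : nat) :
  bounded W s -> env b s -> (i < k)%N -> regs s ri = i -> regs s rx = x ->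
  run W (value_cmd b) s (1 + (1 + (1 + (width b * (1 + (1 + 1) + 2) + 2))))
    (fun s' => regs s' rv = value b x i).
Proof.
move=> bs E ik si sx; rewrite /value_cmd.
apply: run_seq; apply: (run_read W6 (a := (2 + i * (n + 1) + n)%N)) => //=.
- by rewrite si (envN E); lia.
- by rewrite (env_coef E) //; apply: coef_bitlen.
move=> bs1; apply: run_seq; apply: run_assign => //=.
- by case: (b).
- rewrite (envQ E) (env_coef E) //.
  have := side_bitlen x ik (leq0n (width b)).
  by rewrite /side big_geq // addr0.
move=> bs2; apply: run_seq; apply: run_assign => //=.
move=> bs3.
apply: (run_for (M := width b)
  (I := fun j s' => regs s' rv = side b x i j /\ regs s' ry = (x %/ 2 ^ j)%N)) => //=.
- exact: envCnt E.
- rewrite expn0 divn1 sx (envQ E) (env_coef E) //.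
  by rewrite /side big_geq // addr0.
- move=> j s' jw bs' fr sj [sv sy].
  have E' : env b s'.
    apply: (env_frame _ _ fr) => //.
    by case: (E) => *; split.
  have si' : regs s' ri = i by rewrite fr.1.
  have jn : (start b + j <= n)%N by have := start_width b; lia.
  apply: run_seq.
  apply: (run_read W6 (a := (2 + i * (n + 1) + (start b + j))%N)) => //=.
  + by rewrite si' (envN E') (envOff E') sj; lia.
  + by rewrite (env_coef E') //; apply: coef_bitlen.
  move=> bs1'; apply: run_seq.
  have ev : regs s' rv +
     sign_of b * (coef i (start b + j) *
       (regs s' ry - (regs s' ry %/ 2)%Z * 2)) = side b x i j.+1.
    rewrite sv sy /side big_nat_recr //= addrA; congr (_ + _ * (_ * _)).
    by rewrite /bit -modz_nat.
  apply: run_assign => //=.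
  + by case: (b).
  + by rewrite (env_coef E') // ev; apply: side_bitlen.
  move=> bs2'; apply: run_assign => //=.
    apply: leq_trans (bitlen_mono _) (bs' ry).
    by rewrite sy divz_nat; lia.
  rewrite (env_coef E') // ev sy; split=> //.
  by rewrite divz_nat -divnMA -expnSr.
- move=> s' bs' fr [sv _]; rewrite sv /value.
  by have := side_bounds x ik (leqnn (width b)); lia.
Qed.

Lemma code_bitlen b x c m : (c < ntup)%N -> (m <= k)%N ->
  (bitlen (base + code b x c m)%N <= W)%N.
Proof.
move=> cn mk; apply: bitlen_le; first by lia.
apply: leq_ltn_trans W_base.
rewrite leq_add2l (leq_trans (ltnW (code_lt b x cn mk))) //.
by rewrite leq_mul2l leq_pexp2l ?orbT // radix_gt0.
Qed.

Lemma run_digit b s (x c i : nat) :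
  bounded W s -> env b s -> (i < k)%N -> (c < ntup)%N ->
  regs s rv = value b x i -> regs s rd = (c %/ nlev ^ i)%N ->
  regs s rwt = parity b x c i -> regs s rkey = code b x c i ->
  run W (digit_cmd b) s (1 + (1 + ((nlev * 3 + 2) + (1 + 1))))
    (fun s' => [/\ regs s' rd = (c %/ nlev ^ i.+1)%N,
       regs s' rwt = parity b x c i.+1 & regs s' rkey = code b x c i.+1]).
Proof.
move=> bs E ik cn sv sd sw sk; rewrite /digit_cmd.
have el : regs s rd - (regs s rd %/ regs s rL)%Z * regs s rL = level c i.
  by rewrite sd (envL E) -/(modz _ _) modz_nat.
apply: run_seq; apply: run_assign => //=.
  rewrite el; apply: leq_trans (bitlen_mono _) (bs rd).
  by rewrite sd leq_mod.
rewrite el => bs1; apply: run_seq; apply: run_assign => //=.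
  by apply: leq_trans (bitlen_mono _) (bs rd); rewrite -lez_nat; exact: lez_div.
rewrite sd (envL E) divz_nat -divnMA -expnSr => bs2.
(* The number of halvings depends on the digit; [nlev] bounds it uniformly. *)
apply: run_seq; apply: (run_le (u := (level c i * (1 + 2) + 2)%N)).
  by rewrite leq_add2r leq_mul2r ltnW ?ltn_pmod ?orbT // /nlev addn2.
apply: (run_for (M := level c i)
  (I := fun j s' => regs s' rv = (value b x i %/ 2 ^ j)%N)) => //=.
- by rewrite expn0 divn1.
- move=> j s' _ bs' _ sj svj; apply: run_assign => //=.
    by apply: leq_trans (bitlen_mono _) (bs' rv); rewrite -lez_nat; exact: lez_div.
  by rewrite svj divz_nat -divnMA -expnSr.
- move=> s' bs' fr sv' bs''.
  have sw' : regs s' rwt = parity b x c i by rewrite fr.1.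
  have sk' : regs s' rkey = code b x c i by rewrite fr.1.
  have sP' : regs s' rP = radix by rewrite fr.1 //= (envP E).
  have ew : regs s' rwt * (regs s' rv - (regs s' rv %/ 2)%Z * 2)
      = parity b x c i.+1.
    by rewrite sw' sv' -/(modz _ 2) modz_nat /parity big_nat_recr.
  apply: run_seq; apply: run_assign => //=.
    rewrite ew; apply: bitlen_le; first by lia.
    apply: leq_ltn_trans (leq_trans (parity_le1 _ _ _ _) _) (ltn_expl W _) => //.
    by lia.
  have ek : regs s' rkey * regs s' rP + (regs s' rv + int_of_bool b)
      = code b x c i.+1 by rewrite sk' sP' sv'.
  rewrite ew => bs3; apply: run_assign => //=.
  + by case: (b).
  + rewrite ek; apply: leq_trans (bitlen_mono _) (code_bitlen b x cn ik).
    by rewrite !absz_nat leq_addl.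
  split=> //; first by rewrite fr.1.
Qed.

Lemma run_row b s (x c i : nat) :
  bounded W s -> env b s -> (i < k)%N -> (c < ntup)%N ->
  regs s ri = i -> regs s rx = x -> regs s rd = (c %/ nlev ^ i)%N ->
  regs s rwt = parity b x c i -> regs s rkey = code b x c i ->
  run W (value_cmd b ;; digit_cmd b) s (8 * nlev)
    (fun s' => [/\ regs s' rd = (c %/ nlev ^ i.+1)%N,
       regs s' rwt = parity b x c i.+1 & regs s' rkey = code b x c i.+1]).
Proof.
move=> bs E ik cn si sx sd sw sk.
apply: (run_le
  (u := ((1 + (1 + (1 + (width b * (1 + (1 + 1) + 2) + 2)))) +
        (1 + (1 + ((nlev * 3 + 2) + (1 + 1)))))%N)).
  by have := width_le b; rewrite /nlev; nia.
apply: run_seq; apply: run_conseq (run_value bs E ik si sx) (leqnn _) _.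
move=> s' bs' fr sv _; apply: (run_digit bs' _ ik cn) => //.
- by apply: env_frame fr E.
- by rewrite fr.1.
- by rewrite fr.1.
- by rewrite fr.1.
Qed.

Lemma env_set b s x v : x \notin iota 1 8 -> env b s -> env b (set_reg s x v).
Proof.
move=> xn E; apply: (@env_frame b (Assign x (Cst v)) s) => //=.
  by rewrite orbF.
by split=> // y /=; rewrite inE => /negbTE ->.
Qed.

Lemma run_key b s (z : nat) :
  bounded W s -> env b s -> (forall a, (bitlen (Defs.mem s a) <= W)%N) ->
  regs s rz = z ->
  run W (key_cmd b) s (10 * k * nlev)
    (fun s' => [/\ regs s' rkey = address b z, regs s' rwt = pair_parity b z
       & regs s' rm = Defs.mem s (address b z)]).
Proof.
move=> bs E bm sz.
set x := (z %/ ntup)%N; set c := (z %% ntup)%N.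
have cn : (c < ntup)%N by rewrite ltn_pmod // ntup_gt0.
have xE : (regs s rz %/ regs s rC)%Z = x by rewrite sz (envC E) divz_nat.
have cE : regs s rz - x%:Z * regs s rC = c.
  by rewrite -xE sz (envC E) -/(modz _ _) modz_nat.
have xW : (bitlen x <= W)%N.
  by apply: leq_trans (bitlen_mono _) (bs rz); rewrite sz leq_div.
have cW : (bitlen c <= W)%N.
  by apply: leq_trans (bitlen_mono _) (bs rz); rewrite sz leq_mod.
apply: (run_le (u := (1 + (1 + (1 + (1 + ((k * (8 * nlev + 2) + 2) + (1 + 1))))))%N)).
  by have := nlev_ge; nia.
apply: run_seq; apply: run_assign; rewrite //= ?xE // => bs1.
apply: run_seq; apply: run_assign; rewrite //= ?cE // => bs2.
apply: run_seq; apply: run_assign; rewrite //= => bs3.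
apply: run_seq; apply: run_assign; rewrite //=.
  exact: leq_trans W6.
move=> bs4; apply: run_seq.
apply: (run_for (M := k) (I := fun i s' => [/\ regs s' rd = (c %/ nlev ^ i)%N,
   regs s' rwt = parity b x c i & regs s' rkey = code b x c i])) => //=.
- exact: envK E.
- by rewrite expn0 divn1 /parity big_geq.
- move=> i s' ik bs' fr si [sd sw sk]; apply: run_row => //.
    apply: env_frame fr _ => //; by do !apply: env_set.
  by rewrite fr.1.
- move=> s' bs' fr [sd sw sk] bs''.
  have E' : env b s'.
    apply: env_frame fr _ => //; by do !apply: env_set.
  have ea : 2 + regs s' rK * (regs s' rN + 1) + regs s' rkey = address b z.
    by rewrite (envN E') (envK E') sk /address /base -/x -/c; nia.
  apply: run_seq; apply: run_assign; rewrite //= ?ea ?code_bitlen // => bs5.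
  have em : Defs.mem s' = Defs.mem s by rewrite fr.2.
  apply: (run_read W6 (a := address b z)); rewrite //= ?em //.
Qed.

(** * The two passes and the whole program *)

Record globals (s : state) : Prop := Globals {
  globN : regs s rN = n;
  globK : regs s rK = k;
  globL : regs s rL = nlev;
  globQ : regs s rQ = offset;
  globP : regs s rP = radix;
  globC : regs s rC = ntup }.

Lemma globals_frame p s s' :
  ~~ has (fun x => x \in iota 1 6) (modified p) ->
  frame p s s' -> globals s -> globals s'.
Proof.
move=> /hasPn np [fr fm] [] *.
by split; rewrite fr //; apply/negP => /np.
Qed.

Lemma coef_base i j : (i < k)%N -> (j <= n)%N ->
  (2 + i * (n + 1) + j < base)%N.
Proof. by move=> ik jn; rewrite /base; nia. Qed.

Lemma ntup_exp_bitlen m : (m <= n)%N -> (bitlen (ntup * 2 ^ m)%N <= W)%N.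
Proof.
move=> mn; apply: bitlen_le; first by lia.
rewrite absz_nat; apply: leq_ltn_trans W_total.
rewrite mulnC -[leqLHS]muln1 !leq_mul ?ntup_gt0 //.
by rewrite leq_exp2l.
Qed.

(** Serves both passes: [I] may depend only on memory and [rTotal], must bound the cells and
    preserve the input area, and has to be advanced by [table_cmd] alone. *)
Lemma run_phase b (I : nat -> state -> Prop) s :
  bounded W s -> globals s -> I 0%N s ->
  (forall z s1 s2, Defs.mem s2 = Defs.mem s1 ->
     regs s2 rTotal = regs s1 rTotal -> I z s1 -> I z s2) ->
  (forall z s', (z <= npairs b)%N -> I z s' ->
     forall a, (bitlen (Defs.mem s' a) <= W)%N) ->
  (forall z s', I z s' -> forall a, (a < base)%N -> Defs.mem s' a = inp a) ->
  (forall z s', (z < npairs b)%N -> bounded W s' -> I z s' ->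
     regs s' rkey = address b z -> regs s' rwt = pair_parity b z ->
     regs s' rm = Defs.mem s' (address b z) ->
     run W (table_cmd b) s' 2 (I z.+1)) ->
  run W (phase_cmd b) s (13 * k * nlev * npairs b) (I (npairs b)).
Proof.
move=> bs G I0 Iext Ibit Iinp step.
(* Each pair costs at most [11 * k * nlev] with loop overhead; the other [2 * k * nlev * npairs b]
   pay for the setup. *)
apply: (run_le (u := (1 + (1 + (1 +
  ((width b * (1 + 2) + 2) +
   (npairs b * ((10 * k * nlev + 2) + 2) + 2)))))%N)).
  have k_nlev : (nlev <= k * nlev)%N by rewrite leq_pmull.
  have : (npairs b * (10 * k * nlev + 4) <= npairs b * (11 * k * nlev))%N.
    by rewrite leq_mul2l -!mulnA; have := nlev_ge; lia.
  have : (3 * n + 8 <= 2 * (k * nlev) * npairs b)%N.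
    apply: leq_trans (leq_pmulr _ (npairs_gt0 b)).
    have : (3 * n + 8 <= 2 * nlev)%N by rewrite /nlev; nia.
    by lia.
  by have := width_le b; nia.
have eoff : int_of_bool b * (regs s rN %/ 2)%Z = start b.
  by rewrite (globN G) divz_nat /start /int_of_bool; case: (b) => /=; lia.
have ecnt : int_of_bool b * regs s rN + sign_of b * (regs s rN %/ 2)%Z = width b.
  by rewrite (globN G) divz_nat /width /int_of_bool /sign_of; case: (b) => /=; lia.
have nW m : (m <= n)%N -> (bitlen m <= W)%N.
  by move=> mn; apply: leq_trans (bitlen_mono _) (bs rN); rewrite (globN G).
apply: run_seq; apply: run_assign; rewrite //= ?eoff //.
- by case: (b).
- by apply: nW; have := start_width b; lia.
move=> bs1; apply: run_seq; apply: run_assign; rewrite //= ?ecnt //.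
- by case: (b).
- by apply: nW; exact: width_le.
move=> bs2; apply: run_seq; apply: run_assign; rewrite //= => bs3.
apply: run_seq.
apply: (run_for (M := width b)
  (I := fun j s' => regs s' rZn = (ntup * 2 ^ j)%N)) => //=.
- by rewrite expn0 muln1 (globC G).
- move=> j s' jw bs' _ _ sZ.
  have e2 : regs s' rZn + regs s' rZn = (ntup * 2 ^ j.+1)%N.
    by rewrite sZ expnS; lia.
  apply: run_assign; rewrite //= e2 //; apply: ntup_exp_bitlen.
  by have := width_le b; lia.
move=> s1 bs' fr sZ _.
have G1 : globals s1 by apply: globals_frame fr _ => //; case: (G) => *; split.
have I1 : I 0%N s1.
  by apply: Iext I0; [rewrite fr.2 | rewrite fr.1].
have env1 : regs s1 rOff = start b /\ regs s1 rCnt = width b.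
  by split; rewrite fr.1.
move: env1 => {fr} [s1O s1C].
have [kz kZ] : rz \notin modified (key_cmd b ;; table_cmd b) /\
    rZn \notin modified (key_cmd b ;; table_cmd b) by case: (b).
apply: (run_for (M := npairs b) (I := I)) => //.
- by move=> z s' v; apply: Iext.
move=> z s' zn bs'' fr sz Iz.
have E : env b s'.
  have [gN gK gL gQ gP gC] : globals s'.
    by apply: globals_frame fr G1; case: (b).
  have [sO sC] : regs s' rOff = start b /\ regs s' rCnt = width b.
    by rewrite !fr.1 //; case: (b).
  split=> //.
  by move=> i j ik jn; rewrite (Iinp _ _ Iz) // coef_base.
apply: run_seq; apply: run_conseq (run_key bs'' E _ sz) (leqnn _) _.
  by move=> a; apply: Ibit Iz _; exact: ltnW.
move=> s2 bs2' fr2 [sk sw sm] _; apply: step => //.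
- by apply: Iext Iz; [rewrite fr2.2 // | rewrite fr2.1]; case: (b).
- by rewrite sm fr2.2 //; case: (b).
Qed.

Hypothesis inp_n : inp 0 = n.
Hypothesis inp_k : inp 1 = k.
Hypothesis inp_end : forall a, (base <= a)%N -> inp a = 0.

(** Memory during the left pass. A plain sum suffices: [inp] vanishes from [base] on, and [entry]
    below it. *)
Definition cell (m a : nat) : int := inp a + entry m a.

Lemma inp_bitlen a : (bitlen (inp a) <= W)%N.
Proof.
have [ba|ab] := leqP base a.
  by rewrite inp_end //; apply: (@bitlen_nat 0 _ _ base_lt).
have bW := base_lt.
case: a ab => [_|[_|a ab]].
- by rewrite inp_n; apply: bitlen_nat bW; rewrite /base; nia.
- by rewrite inp_k; apply: bitlen_nat bW; rewrite /base; nia.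
have n0 : (0 < n + 1)%N by rewrite addn1.
(* Past the two header cells, position [a] is entry [a %% (n + 1)] of row [a %/ (n + 1)]. *)
have := @coef_bitlen (a %/ (n + 1)) (a %% (n + 1)).
rewrite /coef -addnA -divn_eq add2n; apply.
  by rewrite ltn_divLR //; move: ab; rewrite /base.
by rewrite -ltnS -[X in (_ < X)%N]addn1 ltn_pmod.
Qed.

Lemma cell_bitlen m a : (m <= npairs false)%N -> (bitlen (cell m a) <= W)%N.
Proof.
move=> mp; rewrite /cell; have [ba|ab] := leqP base a.
  rewrite inp_end // add0r; apply: (@bitlen_nat _ _ _ W_total).
  apply: leq_trans (entry_le _ _) (leq_trans mp _).
  by rewrite -npairs_mul leq_pmull ?npairs_gt0.
by rewrite entry_base // addr0 inp_bitlen.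
Qed.

(** A query adds at most [npairs false], so the total is at most [npairs true * npairs false]. *)
Lemma matches_bitlen m : (m <= npairs true)%N -> (bitlen (matches m) <= W)%N.
Proof.
move=> mp; apply: (@bitlen_nat _ _ _ W_total); rewrite -npairs_mul.
apply: leq_trans (leq_mul mp (leqnn _)).
rewrite /matches -[X in (X * _)%N]subn0 -sum_nat_const_nat.
by apply: leq_sum => z _; apply: entry_le.
Qed.

Lemma run_phases s :
  bounded W s -> globals s -> Defs.mem s =1 inp -> regs s rTotal = 0 ->
  run W (phase_cmd false ;; phase_cmd true) s
    (13 * k * nlev * npairs false + 13 * k * nlev * npairs true)
    (fun s' => regs s' rTotal = matches (npairs true)).
Proof.
move=> bs G sm s0; apply: run_seq.
apply: run_conseq (leqnn _) _.
  apply: (run_phase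
    (I := fun z s' => Defs.mem s' =1 cell z /\ regs s' rTotal = 0)) => //=.
  - split=> // a; rewrite sm /cell /entry big_geq ?addr0 //.
  - by move=> z s1 s2 -> ->.
  - by move=> z s' zn [ms _] a; rewrite ms cell_bitlen.
  - by move=> z s' [ms _] a ab; rewrite ms /cell entry_base // addr0.
  move=> z s' zn bs' [ms s'0] sk sw sr.
  apply: (run_write W6 (a := address false z)) => //=.
  split=> // a /=; rewrite sr sw !ms /cell /entry big_nat_recr //=.
  rewrite eq_sym; case: eqP => [->|_]; last by rewrite mul0n addn0.
  by rewrite mul1n; lia.
move=> s1 bs1 fr [ms s10] _.
have G1 : globals s1 by apply: globals_frame fr G.
apply: run_conseq (leqnn _) _.
  apply: (run_phase (I := fun z s' => Defs.mem s' =1 cell (npairs false) /\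
     regs s' rTotal = matches z)) => //=.
  - by split=> //; rewrite s10 /matches big_geq.
  - by move=> z s2 s3 -> ->.
  - by move=> z s' zn [ms' _] a; rewrite ms' cell_bitlen.
  - by move=> z s' [ms' _] a ab; rewrite ms' /cell entry_base // addr0.
  move=> z s' zn bs' [ms' st] sk sw sr.
  have et : regs s' rTotal + regs s' rm = matches z.+1.
    (* The address is at least [base], where the cell holds the table entry alone. *)
    rewrite st sr ms' /cell inp_end /address ?leq_addr // add0r.
    by rewrite /matches big_nat_recr.
  apply: (@run_le _ _ _ 1) => //.
  apply: run_assign; rewrite //= et ?matches_bitlen //.
by move=> s2 _ _ [].
Qed.

Lemma run_main s :
  regs s =1 (fun=> 0) -> Defs.mem s =1 inp ->
  run W main_cmd s (16 * k * nlev * (npairs false + npairs true))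
    (fun s' => regs s' rTotal = matches (npairs true)).
Proof.
move=> s0 sm.
have bs : bounded W s.
  by move=> x; rewrite s0; apply: (@bitlen_nat 0 _ _ base_lt).
(* The setup takes [3 * (n * n + n) + 3 * k + 11] steps, paid for by raising 13 to 16. *)
apply: (run_le
  (u := (1 + (1 + (1 + (1 + (1 + (((n * n + n) * (1 + 2) + 2) +
    (1 + (1 + ((k * (1 + 2) + 2) + 
  (13 * k * nlev * npairs false + 13 * k * nlev * npairs true))))))))))%N)).
  have h0 := npairs_gt0 false; have h1 := npairs_gt0 true.
  have hk : (nlev <= k * nlev)%N by rewrite leq_pmull.
  have hl : (k * 8 <= k * nlev)%N by rewrite leq_mul2l nlev_ge orbT.
  have h : (2 * (k * nlev) <= (npairs false + npairs true) * (k * nlev))%N.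
    by rewrite leq_mul2r; lia.
  have : (n * n + n <= nlev)%N by rewrite leq_addr.
  have := nlev_ge; nia.
have nW : (bitlen nlev <= W)%N := bitlen_nat nlev_le ntup_lt.
apply: run_seq; apply: (run_read W6 (a := 0%N)); rewrite //= sm ?inp_bitlen //.
rewrite inp_n => bs1; apply: run_seq.
apply: (run_read W6 (a := 1%N)); rewrite //= sm ?inp_bitlen // inp_k => bs2.
apply: run_seq; apply: run_assign => //= bs3.
apply: run_seq; apply: run_assign => //=.
  exact: leq_trans W6.
move=> bs4; apply: run_seq; apply: run_assign => //=.
  by apply: leq_trans (bitlen_mono _) nW; rewrite /nlev; lia.
move=> bs5; apply: run_seq.
apply: (run_for (M := (n * n + n)%N)
  (I := fun j s' => regs s' rQ = (2 ^ j)%N)) => //=.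
  move=> j s' jn bs' _ _ sQ.
  have e2 : regs s' rQ + regs s' rQ = (2 ^ j.+1)%N.
    by rewrite sQ expnS; lia.
  apply: run_assign; rewrite //= e2 //.
  apply: bitlen_nat offset_bitlen.
  by apply: leq_trans (leq_pmull _ _); rewrite ?leq_exp2l.
move=> s1 bs1' fr1 sQ _; apply: run_seq.
have eP : 8 * regs s1 rQ = radix by rewrite sQ.
apply: run_assign; rewrite //= eP //.
  apply: bitlen_nat W_base; apply: leq_trans (leq_addl _ _).
  apply: leq_trans (leq_pmull _ ntup_gt0).
  by rewrite -[leqLHS]expn1 leq_pexp2l // radix_gt0.
move=> bs6; apply: run_seq; apply: run_assign => //=.
  exact: leq_trans W6.
move=> bs7; apply: run_seq.
have [sN sK sL] : [/\ regs s1 rN = n, regs s1 rK = k & regs s1 rL = nlev].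
  by split; rewrite fr1.1 //=; lia.
apply: (run_for (M := k) (I := fun j s' => regs s' rC = (nlev ^ j)%N)) => //=.
  move=> j s' jk bs' fr _ sC.
  have eC : regs s' rC * regs s' rL = (nlev ^ j.+1)%N.
    by rewrite sC expnSr fr.1 //= sL.
  apply: run_assign; rewrite //= eC //.
  apply: bitlen_nat ntup_lt.
  by rewrite leq_pexp2l // /nlev addn2.
move=> s2 bs2' fr2 sC _; apply: run_phases => //.
- split=> //; rewrite fr2.1 //=.
- by move=> a; rewrite fr2.2 //= fr1.2 //= sm.
- by rewrite fr2.1 //= fr1.1 //= s0.
Qed.

End Algorithm.

(** * Input layout and running time *)

Lemma nth_flatten_const (T : Type) (x0 : T) (m i j : nat) (ss : seq (seq T)) :
  all (fun s => size s == m) ss -> (i < size ss)%N -> (j < m)%N ->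
  nth x0 (flatten ss) (i * m + j) = nth x0 (nth [::] ss i) j.
Proof.
elim: ss i => [|s ss IH] [|i] //= /andP[/eqP sm /IH {}IH] iss jm.
  by rewrite mul0n add0n nth_cat sm jm.
by rewrite nth_cat sm mulSn -addnA ltnNge leq_addr /= addKn IH.
Qed.

Lemma size_flatten_const (T : Type) (m : nat) (ss : seq (seq T)) :
  all (fun s => size s == m) ss -> size (flatten ss) = (size ss * m)%N.
Proof.
by elim: ss => //= s ss IH /andP[/eqP sm /IH e]; rewrite size_cat sm e mulSn.
Qed.

Section Input.
Context (n k : nat) (f : 'I_k -> ltf n).

Let row (i : 'I_k) : seq int :=
  rcons [seq weight (f i) j | j <- enum 'I_n] (threshold (f i)).

Let rows_size : all (fun s => size s == n.+1) [seq row i | i <- enum 'I_k].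
Proof.
by apply/allP => _ /mapP[i _ ->]; rewrite size_rcons size_map size_enum_ord.
Qed.

Let coef_row (i : 'I_k) (j : nat) : (j <= n)%N ->
  coef n (nth 0 (input f)) i j = nth 0 (row i) j.
Proof.
move=> jn; rewrite /coef -addnA add2n /= addn1.
have ik : (i < size [seq row i | i <- enum 'I_k])%N.
  by rewrite size_map size_enum_ord.
rewrite (nth_flatten_const _ rows_size ik) //.
by rewrite (nth_map i) ?size_enum_ord // nth_ord_enum.
Qed.

Lemma coef_weight (i : 'I_k) (j : 'I_n) :
  coef n (nth 0 (input f)) i j = weight (f i) j.
Proof.
rewrite coef_row 1?ltnW // nth_rcons size_map size_enum_ord ltn_ord.
by rewrite (nth_map j) ?size_enum_ord // nth_ord_enum.
Qed.

Lemma coef_threshold (i : 'I_k) :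
  coef n (nth 0 (input f)) i n = threshold (f i).
Proof. by rewrite coef_row // nth_rcons size_map size_enum_ord ltnn eqxx. Qed.

Lemma input_end (a : nat) : (base n k <= a)%N -> nth 0 (input f) a = 0.
Proof.
move=> ba; apply: nth_default; apply: leq_trans ba.
rewrite /base /input size_cat /= (size_flatten_const rows_size).
by rewrite size_map size_enum_ord addn1.
Qed.

End Input.

(** Here [radix = 2 ^ (nlev + 1)] and [ntup <= 2 ^ (k * nlev)], so addresses stay below
    [2 * 2 ^ (3 * k * nlev)] up to equality, and the total is at most [2 ^ (n + 2 * k * nlev)]. *)
Definition word (n k : nat) : nat := (4 * (k * nlev n))%N.

Section Bounds.
Context (n k : nat) (n2 : (2 <= n)%N) (k1 : (1 <= k)%N).

Lemma ntup_le : (ntup n k <= 2 ^ (k * nlev n))%N.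
Proof.
rewrite /ntup mulnC expnM leq_exp2r //.
exact: ltnW (ltn_expl _ _).
Qed.

Lemma word_base : (base n k + ntup n k * radix n ^ k < 2 ^ word n k)%N.
Proof.
have l8 := nlev_ge n2.
have kl : (nlev n <= k * nlev n)%N by rewrite leq_pmull.
have hb : (base n k <= 2 ^ (3 * (k * nlev n)))%N.
  apply: leq_trans (ltnW (ltn_expl _ (ltnSn 1))).
  by rewrite /base; move: l8; rewrite /nlev; nia.
have hc : (ntup n k * radix n ^ k <= 2 ^ (3 * (k * nlev n)))%N.
  apply: leq_trans (leq_mul ntup_le (leqnn _)) _.
  rewrite /radix /offset -[8%N]/(2 ^ 3)%N -expnD -expnM -expnD leq_exp2l //.
  by move: l8 kl; rewrite /nlev; nia.
apply: leq_ltn_trans (leq_add hb hc) _.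
by rewrite addnn -mul2n -expnS ltn_exp2l // /word; lia.
Qed.

Lemma word_total : (2 ^ n * ntup n k * ntup n k < 2 ^ word n k)%N.
Proof.
have kl : (nlev n <= k * nlev n)%N by rewrite leq_pmull.
apply: leq_ltn_trans (leq_mul (leq_mul (leqnn _) ntup_le) ntup_le) _.
rewrite -!expnD ltn_exp2l // /word.
have : (n < nlev n)%N by rewrite /nlev; nia.
by lia.
Qed.

(** The exponent is [25 = 14 + 2 + 6 + 3], from [2 ^ 14], [k * k], [nlev * nlev] and [ntup], each
    bounded by a power of [n >= 2]. *)
Lemma time_le :
  (16 * k * nlev n * (npairs n k false + npairs n k true) * (64 * word n k) <=
   2 ^ (n %/ 2) * n ^ (25 * k))%N.
Proof.
have n0 : (0 < n)%N by lia.
have l3 : (nlev n <= n ^ 3)%N by rewrite /nlev !expnS expn0; nia.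
have kn : (k <= n ^ k)%N.
  by apply: leq_trans (ltnW (ltn_expl k n2)) _.
have cn : (ntup n k <= n ^ (3 * k))%N by rewrite /ntup expnM leq_exp2r.
have c14 : (2 ^ 14 <= n ^ (14 * k))%N.
  by apply: leq_trans (leq_pexp2l n0 (leq_pmulr 14 k1)); rewrite leq_exp2r.
have pairs : (npairs n k false + npairs n k true <=
    4 * (2 ^ (n %/ 2) * ntup n k))%N.
  rewrite /npairs /width.
  (* The right half has at most one variable more than the left. *)
  have h : (2 ^ (n - n %/ 2) <= 2 ^ (n %/ 2).+1)%N by rewrite leq_exp2l //; lia.
  have := leq_mul (leqnn (ntup n k)) h.
  by rewrite expnS; lia.
have l6 : (nlev n * nlev n <= n ^ (6 * k))%N.
  apply: leq_trans (leq_mul l3 l3) _.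
  by rewrite -expnD leq_pexp2l //; lia.
have k2 : (k * k <= n ^ (2 * k))%N.
  by apply: leq_trans (leq_mul kn kn) _; rewrite -expnD addnn -mul2n.
(* [2 ^ 14 = 16 * 4 * 64 * 4] collects the constants of the step count, the number of pairs, the
   cost of a step and the word length. *)
apply: leq_trans (_ : 2 ^ (n %/ 2) *
  (2 ^ 14 * (k * k) * (nlev n * nlev n) * ntup n k) <= _)%N.
  rewrite /word; set l := nlev n.
  apply: leq_trans (_ : 16 * k * l * (4 * (2 ^ (n %/ 2) * ntup n k)) *
    (64 * (4 * (k * l))) <= _)%N.
    by rewrite leq_mul2r leq_mul2l pairs !orbT.
  by rewrite (_ : 2 ^ 14 = 16 * 4 * 64 * 4)%N //; lia.
rewrite leq_mul2l; apply/orP; right.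
apply: leq_trans (leq_mul (leq_mul (leq_mul c14 k2) l6) cn) _.
by rewrite -!expnD leq_pexp2l //; lia.
Qed.

End Bounds.

Theorem theorem4p1 :
  exists (p : cmd) (c : nat),
  forall (n k : nat) (f : 'I_k -> ltf n),
    (2 <= n)%N -> (1 <= k)%N ->
    (forall i : 'I_k, ltf_bounded (f i)) ->
    exists (T : nat) (s : state),
      [/\ exec p (init (input f)) T s,
          regs s 0%N =
            (\sum_(x : {ffun 'I_n -> bool}) \prod_(i < k) ltf_eval (f i) x)%N%:Z
        & forall R : realType,
            T%:R <= 2 `^ (n%:R / 2) * n%:R ^+ (c * k) :> R].
Proof.
exists main_cmd, 25%N => n k f n2 k1 fb.
have coef_le i j : (i < k)%N -> (j <= n)%N ->
    (`|coef n (nth 0%R (input f)) i j| <= n ^ n)%N.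
  move=> ik; rewrite leq_eqVlt => /predU1P[->|jn].
    rewrite (coef_threshold f (Ordinal ik)).
    by have [_] := fb (Ordinal ik); lia.
  rewrite (coef_weight f (Ordinal ik) (Ordinal jn)).
  by have [/(_ (Ordinal jn))] := fb (Ordinal ik); lia.
have W6 : (6 <= word n k)%N.
  have := nlev_ge n2; have : (nlev n <= k * nlev n)%N by rewrite leq_pmull.
  by rewrite /word; lia.
have [T [s [ex tT _ st]]] := run_main n2 coef_le k1 W6 (word_base n2 k1)
  (word_total n2 k1) (erefl _) (erefl _) (@input_end n k f)
  (s := init (input f)) (frefl _) (frefl _).
exists T, s; split=> //.
  rewrite st (matches_eq n2 coef_le); congr Posz.
  rewrite sum_ffun_bits; apply: eq_bigr => z _; rewrite big_mkord.
  apply: eq_bigr => i _; congr nat_of_bool.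
  rewrite /ltf_eval coef_threshold big_mkord; congr (_ <= _).
  by apply: eq_bigr => j _; rewrite coef_weight ffunE /bit modn2.
move=> R; apply: le_trans (_ : (2 ^ (n %/ 2) * n ^ (25 * k))%N%:R <= _).
  by rewrite ler_nat; apply: leq_trans tT (time_le n2 k1).
rewrite natrM !natrX ler_wpM2r ?exprn_ge0 //.
(* The integer quotient [n %/ 2] is at most the real number [n / 2]. *)
rewrite -powR_mulrn // ler_powR ?ler1n //.
by rewrite ler_pdivlMr // -natrM ler_nat leq_trunc_div.
Qed.
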